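(* Let $n$ be a nonnegative integer and let $\Theta=\left\lfloor \log_{10}\binom{n}{\lfloor n/2\rfloor}\right\rfloor$. Let $(1\Theta 1)$ denote the integer whose decimal expansion is a $1$, followed by $\Theta$ zeros, followed by a $1$, i.e. $(1\Theta1)=10^{\Theta+1}+1$. Then for every integer $r$ with $1\le r\le n+1$, the $r$-th block of $\Theta+1$ decimal digits, counted from the right, of the integer $(1\Theta 1)^n$ is the binomial coefficient $\binom{n}{r-1}$; that is, $$\left\lfloor \frac{(10^{\Theta+1}+1)^n}{10^{(r-1)(\Theta+1)}}\right\rfloor \bmod 10^{\Theta+1}=\binom{n}{r-1}.$$
   Context: For a nonnegative integer $N$ written in base $10$ (padded on the left with zeros as needed), the $r$-th block of $\Theta+1$ digits from the right is the integer whose decimal digits are those of $N$ in positions $(r-1)(\Theta+1)$ through $r(\Theta+1)-1$, where position $0$ is the units digit; leading zeros in a block are allowed and ignored. Equivalently it is $\lfloor N/10^{(r-1)(\Theta+1)}\rfloor \bmod 10^{\Theta+1}$, where $a \bmod m$ denotes the remainder in $\{0,\dots,m-1\}$. *)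

(* Defs.v *)
From mathcomp Require Import all_boot all_order all_algebra archimedean.
From mathcomp Require Import reals exp.

Set Implicit Arguments.
Unset Strict Implicit.
Unset Printing Implicit Defensive.

Definition log10 (R : realType) (x : R) : R := (ln x / ln 10%:R)%R.

(* floor is int-valued; since 'C(n, n./2) >= 1 its value here is nonnegative,
   so taking the absolute value only casts it to nat. *)
Definition Theta (R : realType) (n : nat) : nat :=
  `|Num.floor (log10 ('C(n, n./2)%:R : R)%R)|%N.

(* Most significant digit first. *)
Definition of_digits10 (s : seq nat) : nat :=
  foldl (fun acc d => 10 * acc + d) 0 s.

(* (1 T 1): a 1, then T zeros, then a 1. *)
Definition one_zeros_one (T : nat) : nat :=
  of_digits10 (1 :: nseq T 0 ++ [:: 1]).

(* Position 0 is the units digit; positions beyond the length of N give 0. *)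
Definition digit10 (N i : nat) : nat := N %/ 10 ^ i %% 10.

(* The integer with the decimal digits of N in positions
   (r - 1) w, ..., r w - 1: the r-th block (r >= 1) of w digits from the
   right. *)
Definition block (w N r : nat) : nat :=
  \sum_(j < w) digit10 N ((r - 1) * w + j) * 10 ^ j.

(* Main.v *)
(** With B = 10^(Theta+1), the binomial theorem reads (B+1)^n = sum_i C(n,i) B^i.
    Each coefficient is at most the central one, which is below B by the choice
    of Theta, so this is the base-B expansion of (B+1)^n. *)
Require Import Defs.
From mathcomp Require Import all_boot all_order all_algebra.
From mathcomp Require Import reals.
From mathcomp Require Import archimedean exp zify.

Import Order.TTheory GRing.Theory Num.Theory.

(** Since (k+1) C(n,k+1) = (n-k) C(n,k), the coefficients do not decrease while k+1 <= n-k; the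
    symmetry k -> n-k covers the upper half. *)
Lemma leq_bin_half n m : 'C(n, m) <= 'C(n, n./2).
Proof.
have low d : 'C(n, n./2 - d) <= 'C(n, n./2).
  elim: d => [|d IHd]; first by rewrite subn0.
  (* For [d >= n./2] truncated subtraction makes both indices 0. *)
  apply: leq_trans IHd; have [le_nd|lt_dn] := leqP n./2 d.
    by rewrite (_ : n./2 - d.+1 = n./2 - d) //; lia.
  rewrite (_ : n./2 - d = (n./2 - d.+1).+1); last by lia.
  set k := n./2 - d.+1.
  rewrite -(leq_pmul2l (ltn0Sn k)) mul_bin_left leq_mul2r; lia.
have [le_mh|lt_hm] := leqP m n./2; first by rewrite -(subKn le_mh).
have [le_mn|lt_nm] := leqP m n; last by rewrite bin_small.
by rewrite -bin_sub // (_ : n - m = n./2 - (n./2 - (n - m))) //; lia.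
Qed.

Lemma sum_digits b M w :
  0 < b -> \sum_(j < w) (M %/ b ^ j %% b) * b ^ j = M %% b ^ w.
Proof.
move=> b_gt0; elim: w => [|w IHw]; first by rewrite big_ord0 modn1.
(* Splits [M] at digit [w]; the bracket, digit [w] with those below it, stays under [b ^ w.+1] and
   so is the remainder. *)
have M_eq : M = M %/ b ^ w %/ b * b ^ w.+1
                + (M %/ b ^ w %% b * b ^ w + M %% b ^ w).
  by rewrite expnS mulnA addnA -mulnDl -divn_eq -divn_eq.
rewrite big_ord_recr /= IHw [in RHS]M_eq modnMDl [RHS]modn_small addnC //.
apply: (@leq_trans ((M %/ b ^ w %% b).+1 * b ^ w)).
  by rewrite mulSn -addSn leq_add2r ltn_mod expn_gt0 b_gt0.
by rewrite expnS leq_mul2r ltn_mod b_gt0 orbT.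
Qed.

(** No carries occur as every [a i] is below [B]: dividing by [B] drops [a 0] and shifts the
    sequence, hence the induction with [a] general. *)
Lemma digit_sum B m (a : nat -> nat) k : (forall i, a i < B) -> k < m ->
  (\sum_(i < m) a i * B ^ i) %/ B ^ k %% B = a k.
Proof.
move=> a_lt; have B_gt0 : 0 < B by apply: leq_ltn_trans (a_lt 0).
elim: k m a a_lt => [|k IHk] [//|m] a a_lt km; rewrite big_ord_recl /= muln1;
  under eq_bigr => i _ do rewrite /bump add1n expnSr mulnA;
  rewrite -big_distrl /= addnC.
  by rewrite divn1 modnMDl modn_small.
rewrite expnS divnMA divnMDl // (divn_small (a_lt 0)) addn0.
exact: (IHk m (fun i => a i.+1)).
Qed.

Lemma ltn_exp10_floor_log10 (R : realType) k : 0 < k ->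
  k < 10 ^ (`|Num.floor (log10 (k%:R : R)%R)|%N + 1).
Proof.
move=> k_gt0; set x := log10 _; set t := absz _.
have ln10_gt0 : (0 < ln (10%:R : R))%R by rewrite ln_gt0 // ltr1n.
(* The absolute value can only raise the floor, so its sign is irrelevant here. *)
have x_lt : (x < (t + 1)%:R)%R.
  apply: (lt_le_trans (floorD1_gt x)).
  by rewrite -[_%:R%R]/((Posz _)%:~R)%R ler_int PoszD lerD2r ler_norm.
(* Clearing the denominator gives ln k < ln (10^(t+1)), and [ln] is strictly increasing on
   positives. *)
move: x_lt; rewrite ltr_pdivrMr // mulr_natl -lnXn ?ltr0n // -natrX.
by rewrite ltr_ln ?posrE ?ltr0n ?expn_gt0 // ltr_nat.
Qed.

Lemma one_zeros_oneE T : one_zeros_one T = 10 ^ (T + 1) + 1.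
Proof.
(* Each zero read multiplies the accumulator by 10. *)
have shift c : foldl (fun acc d => 10 * acc + d) c (nseq T 0) = 10 ^ T * c.
  elim: T c => [|T IHT] c /=; first by rewrite mul1n.
  by rewrite IHT addn0 mulnA -expnSr.
rewrite /one_zeros_one /of_digits10 /= foldl_cat /= shift muln1.
by rewrite [T + 1]addn1 expnS.
Qed.

Lemma blockE w N r : block w N r = N %/ 10 ^ ((r - 1) * w) %% 10 ^ w.
Proof.
rewrite -sum_digits //; apply: eq_bigr => j _.
by rewrite /digit10 expnD divnMA.
Qed.

Theorem theorem1 (R : realType) (n r : nat) (hr : 1 <= r <= n + 1) :
  block (Theta R n + 1) (one_zeros_one (Theta R n) ^ n) r = 'C(n, r - 1)
  /\ (10 ^ (Theta R n + 1) + 1) ^ n %/ 10 ^ ((r - 1) * (Theta R n + 1))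
       %% 10 ^ (Theta R n + 1) = 'C(n, r - 1).
Proof.
rewrite blockE one_zeros_oneE; set B := 10 ^ _.
(* Both conjuncts have become this one equation. *)
suff E : (B + 1) ^ n %/ 10 ^ ((r - 1) * (Theta R n + 1)) %% B = 'C(n, r - 1).
  by [].
have bin_ltB i : 'C(n, i) < B.
  apply: leq_ltn_trans (leq_bin_half n i) _.
  by apply: ltn_exp10_floor_log10; rewrite bin_gt0; lia.
(* Writing the base as [1 + B] makes [expnDn] pair 'C(n, i) with [B ^ i]. *)
rewrite mulnC expnM -/B addnC expnDn.
under eq_bigr => i _ do rewrite exp1n mul1n.
by apply: (digit_sum B n.+1 (fun i => 'C(n, i))) => //; lia.
Qed.
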